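(* Let $\mathcal{R}$ be a (finite) set of $n$ resources and $\lhd$ a linear order over $\mathcal{R}$. For every preference domain $D$ (a set of linear orders over $\mathcal{R}$) such that $\mathcal{SP}_\lhd\subsetneq D$, there exists an instance $I=\langle \mathcal{N},\mathcal{R},L,\pi^0\rangle$ defined over $D$ such that swap dynamics on $I$ do not reach a Pareto-optimal allocation; that is, no allocation that is reachable from $\pi^0$ by a (possibly empty) sequence of improving swap-deals and from which no improving swap-deal is possible is Pareto-optimal.
   Context: Housing market: $\mathcal{N}=\{a_1,\dots,a_n\}$ is a set of $n$ agents and $\mathcal{R}=\{r_1,\dots,r_n\}$ a set of $n$ resources. An allocation $\pi$ is a bijective assignment of exactly one resource $\pi_{a_i}$ to each agent $a_i$. Each agent $a_i$ has a strict linear order $\succ_i$ over $\mathcal{R}$; $L=\langle\succ_i\mid a_i\in\mathcal{N}\rangle$ is the preference profile (several agents may have the same order) and $\pi^0$ the initial allocation. An instance is $I=\langle \mathcal{N},\mathcal{R},L,\pi^0\rangle$. A preference domain is a subset $D$ of the set of all linear orders over $\mathcal{R}$; $I$ is defined over $D$ if $\succ_i\in D$ for every agent $a_i$. $\mathcal{SP}_\lhd$ is the set of all linear orders $\succ$ over $\mathcal{R}$ that are single-peaked with respect to $\lhd$: writing $top(\succ)$ for the top-ranked element of $\succ$, for all $r,r'\in\mathcal{R}$, if $r'\lhd r\lhd top(\succ)$ or $top(\succ)\lhd r\lhd r'$ then $r\succ r'$. A swap-deal from $\pi$ between two distinct agents $a_i,a_j$ exchanges their resources; it is improving if both strictly prefer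 the resource they receive to the one they give away. Swap dynamics start from $\pi^0$ and successively implement improving swap-deals (selected in some way) until an allocation from which no improving swap-deal exists is reached. An allocation $\pi'$ Pareto-dominates $\pi$ if every agent $a_i$ has $\pi'_{a_i}\succ_i\pi_{a_i}$ or $\pi'_{a_i}=\pi_{a_i}$, with $\pi'_{a_j}\succ_j\pi_{a_j}$ for at least one agent $a_j$; $\pi$ is Pareto-optimal if no allocation Pareto-dominates it. *)

(* Defs.v *)
From HB Require Import structures.
From mathcomp Require Import all_boot perm.

Set Implicit Arguments.
Unset Strict Implicit.
Unset Printing Implicit Defensive.

(* Linear orders are strict and stored as graphs, so that they form a finite
   type on which Leibniz equality is extensional and a preference domain is a
   {set lorder R}. *)
Definition strict_linear (R : finType) (G : {set R * R}) : bool :=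
  [&& [forall x, (x, x) \notin G],
      [forall x, forall y, forall z,
         ((x, y) \in G) && ((y, z) \in G) ==> ((x, z) \in G)]
    & [forall x, forall y, (x != y) ==> ((x, y) \in G) || ((y, x) \in G)]].

Record lorder (R : finType) := LOrder {
  graph : {set R * R};
  _ : strict_linear graph
}.

HB.instance Definition _ (R : finType) := [isSub for @graph R].
HB.instance Definition _ (R : finType) := [Finite of lorder R by <:].

(* P x y means that x comes strictly before y; for a preference order, that x
   is strictly preferred to y. *)
Definition precedes (R : finType) (P : lorder R) : rel R :=
  fun x y => (x, y) \in graph P.

Coercion precedes : lorder >-> rel.

Lemma lorderP (R : finType) (P : lorder R) :
  [/\ irreflexive P, transitive P & forall x y, x != y -> P x y || P y x].
Proof.
case: P => G GP; rewrite /precedes /=.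
case/and3P: (GP) => /forallP irr /forallP tr /forallP tot; split.
- by move=> x; apply/negbTE/irr.
- move=> y x z Gxy Gyz.
  by move/forallP/(_ y)/forallP/(_ z)/implyP: (tr x); apply; apply/andP.
- by move=> x y; move/forallP/(_ y)/implyP: (tot x).
Qed.

Definition is_top (R : finType) (P : lorder R) (t : R) : bool :=
  [forall r, (r != t) ==> P t r].

(* is_top P holds of exactly one element as soon as R is inhabited. *)
Lemma is_top_exists (R : finType) (P : lorder R) (r0 : R) :
  exists t, is_top P t.
Proof.
have [irr tr tot] := lorderP P.
have [t _ tmin] := @arg_minnP R r0 xpredT (fun t => #|[set r | P r t]|) isT.
exists t; apply/forallP => r; apply/implyP => rNt.
case/orP: (tot _ _ rNt) => // Prt.
have: [set s | P s r] \proper [set s | P s t].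
  apply/properP; split; last by exists r; rewrite !inE ?irr.
  by apply/subsetP => s; rewrite !inE => Psr; apply: tr Psr Prt.
by move/proper_card; rewrite ltnNge tmin.
Qed.

Lemma is_top_unique (R : finType) (P : lorder R) (s t : R) :
  is_top P s -> is_top P t -> s = t.
Proof.
have [irr tr _] := lorderP P.
move=> /forallP/(_ t)/implyP Ps /forallP/(_ s)/implyP Pt.
apply/eqP/negPn/negP => sNt.
have Pst : P s t by apply: Ps; rewrite eq_sym.
by have := tr _ _ _ Pst (Pt sNt); rewrite irr.
Qed.

Definition single_peaked (R : finType) (lhd P : lorder R) : bool :=
  [forall t, is_top P t ==>
    [forall r, forall r',
      (lhd r' r && lhd r t) || (lhd t r && lhd r r') ==> P r r']].

Definition SP (R : finType) (lhd : lorder R) : {set lorder R} :=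
  [set P | single_peaked lhd P].

Definition bijectiveb (N R : finType) (f : {ffun N -> R}) : bool :=
  injectiveb f && [forall r, r \in codom f].

Record allocation (N R : finType) := Allocation {
  assigned :> {ffun N -> R};
  _ : bijectiveb assigned
}.

HB.instance Definition _ (N R : finType) := [isSub for @assigned N R].
HB.instance Definition _ (N R : finType) := [Finite of allocation N R by <:].

Lemma bijectiveb_swap (N R : finType) (pi : allocation N R) (a b : N) :
  bijectiveb [ffun c => pi (tperm a b c)].
Proof.
case/andP: (valP pi) => /injectiveP pi_inj /forallP pi_surj.
apply/andP; split.
  by apply/injectiveP => c d; rewrite !ffunE => /pi_inj/perm_inj.
apply/forallP => r; have /codomP[c ->] := pi_surj r.
by apply/codomP; exists (tperm a b c); rewrite ffunE tpermK.
Qed.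

Definition swap_deal (N R : finType) (pi : allocation N R) (a b : N) :
  allocation N R :=
  Allocation (bijectiveb_swap pi a b).

Record market (N R : finType) := Market {
  pref : N -> lorder R;
  initial : allocation N R
}.

Definition defined_over (N R : finType) (D : {set lorder R})
  (I : market N R) : bool :=
  [forall a, pref I a \in D].

Definition improving_pair (N R : finType) (I : market N R)
  (pi : allocation N R) (a b : N) : bool :=
  [&& a != b, pref I a (pi b) (pi a) & pref I b (pi a) (pi b)].

Definition improving_swap (N R : finType) (I : market N R) :
  rel (allocation N R) :=
  fun pi pi' => [exists a, exists b,
    improving_pair I pi a b && (pi' == swap_deal pi a b)].

Definition swap_stable (N R : finType) (I : market N R)
  (pi : allocation N R) : bool :=
  [forall a, forall b, ~~ improving_pair I pi a b].

Definition swap_reachable (N R : finType) (I : market N R)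
  (pi : allocation N R) : bool :=
  connect (improving_swap I) (initial I) pi.

Definition pareto_dominates (N R : finType) (I : market N R)
  (pi' pi : allocation N R) : bool :=
  [forall a, pref I a (pi' a) (pi a) || (pi' a == pi a)] &&
  [exists a, pref I a (pi' a) (pi a)].

Definition pareto_optimal (N R : finType) (I : market N R)
  (pi : allocation N R) : bool :=
  [forall pi', ~~ pareto_dominates I pi' pi].

(* Main.v *)
Require Import Defs.
From mathcomp Require Import all_boot.
From mathcomp Require Import perm.

(** An order outside [SP lhd] has a valley: resources [a], [b], [t] with [b]
    strictly between [a] and [t] on the axis, [t] its top, and [a] preferred to
    [b].  Give this order to the owner of [a].  Give the owner of [b] a
    single-peaked order with peak [a] (so that [b] beats [t]), the owner of [t]
    a single-peaked order with peak [b] that ranks the side of [t] before the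
    side of [a], and every other agent a single-peaked order whose peak is the
    resource it owns.  No two agents can gain by a swap, yet the three-cycle on
    [a], [b], [t] gives every agent its favourite resource. *)

Set Implicit Arguments.
Unset Strict Implicit.
Unset Printing Implicit Defensive.

Section LinearOrders.

Variables (R : finType) (P : lorder R).

Lemma lorder_irr x : P x x = false.
Proof. by have [-> _ _] := lorderP P. Qed.

Lemma lorder_trans : transitive P.
Proof. by have [] := lorderP P. Qed.

Lemma lorder_total x y : x != y -> P x y || P y x.
Proof. by have [_ _] := lorderP P; apply. Qed.

Lemma lorder_asym x y : P x y -> P y x = false.
Proof.
by move=> Pxy; apply/negP => /(lorder_trans Pxy); rewrite lorder_irr.
Qed.

Lemma lorder_neq x y : P x y -> x != y.
Proof. by apply: contraTneq => ->; rewrite lorder_irr. Qed.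

Lemma is_topN t r : is_top P t -> P r t = false.
Proof.
move=> /forallP/(_ r)/implyP Pt; have [->|/Pt] := eqVneq r t.
  exact: lorder_irr.
exact: lorder_asym.
Qed.

Lemma is_top_le t r : is_top P t -> P t r || (t == r).
Proof.
move=> /forallP/(_ r)/implyP; rewrite eq_sym.
by case: eqVneq => [|_ ->]; rewrite ?orbT.
Qed.

End LinearOrders.

Lemma lorder_of_rel (R : finType) (e : rel R) :
  irreflexive e -> transitive e -> (forall x y, x != y -> e x y || e y x) ->
  exists P : lorder R, forall x y, P x y = e x y.
Proof.
move=> irr tr tot.
have eP : strict_linear [set p : R * R | e p.1 p.2].
  apply/and3P; split; apply/forallP => x; first by rewrite inE irr.
    apply/forallP => y; apply/forallP => z; rewrite !inE /=.
    by apply/implyP => /andP[]; apply: tr.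
  by apply/forallP => y; rewrite !inE; apply/implyP/tot.
by exists (LOrder eP) => x y; rewrite /precedes inE.
Qed.

Section SinglePeaked.

Variables (R : finType) (lhd : lorder R).

(** Covers both directions of the axis, so it is invariant under reversing [lhd], and
    single-peakedness becomes one condition on moving away from the top. *)
Definition between (x y z : R) : bool :=
  (lhd x y && lhd y z) || (lhd z y && lhd y x).

Lemma single_peakedP (P : lorder R) t : is_top P t ->
  reflect (forall r r', between t r r' -> P r r') (single_peaked lhd P).
Proof.
move=> tP; apply: (iffP idP) => [|Pbtw].
  move=> /forallP/(_ t)/implyP/(_ tP)/forallP btwP r r' btw.
  by move/forallP/(_ r')/implyP: (btwP r); apply; rewrite orbC.
apply/forallP => s; apply/implyP => sP; rewrite (is_top_unique sP tP).
apply/forallP => r; apply/forallP => r'; apply/implyP => btw.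
by apply: Pbtw; rewrite /between orbC.
Qed.

Lemma not_single_peaked_valley (P : lorder R) :
  ~~ single_peaked lhd P ->
  exists t a b, [/\ is_top P t, between a b t & P a b].
Proof.
case/forallPn => t; rewrite negb_imply => /andP[tP].
case/forallPn => b /forallPn[a]; rewrite negb_imply => /andP[btw PNba].
exists t, a, b; split=> //.
have aNb : a != b.
  case/orP: btw => /andP[/lorder_neq h1 /lorder_neq h2] //.
  by rewrite eq_sym.
by case/orP: (lorder_total P aNb) => // Pba; rewrite Pba in PNba.
Qed.

(** Single-peakedness does not constrain how resources on opposite sides of the peak compare, so one
    whole side can be ranked first. *)
Lemma single_peaked_up_first (x : R) :
  exists P : lorder R, [/\ single_peaked lhd P, is_top P x
    & forall a c, lhd a x -> lhd x c -> P c a].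
Proof.
have asym := @lorder_asym _ lhd; have tr := @lorder_trans _ lhd.
(* [x] comes first, then the resources after [x] in increasing order, then
   those before [x] in decreasing order. *)
pose e : rel R := fun y z => if lhd y x then lhd z x && lhd z y
                             else lhd z x || lhd y z.
have [||| P eP] := @lorder_of_rel _ e.
- by move=> y; rewrite /e lorder_irr andbF orbF; case: ifP.
- move=> y w z; rewrite /e.
  case wx: (lhd w x); case yx: (lhd y x); case zx: (lhd z x) => //=.
    by move=> yw zy; apply: tr zy yw.
  exact: tr.
- move=> y z yNz; rewrite /e.
  have := lorder_total lhd yNz.
  by case: (lhd y x); case: (lhd z x); rewrite //= orbC.
have xP : is_top P x.
  apply/forallP => r; apply/implyP => rNx.
  by rewrite eP /e lorder_irr lorder_total.
exists P; split=> //; last first.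
  by move=> a c ax xc; rewrite eP /e (asym _ _ xc) ax.
apply/(single_peakedP xP) => r r' /orP[]/andP[h1 h2]; rewrite eP /e.
  by rewrite (asym _ _ h1) h2 orbT.
by rewrite h2 h1 (tr _ _ _ h1 h2).
Qed.

End SinglePeaked.

Lemma reverse_lorder (R : finType) (lhd : lorder R) :
  exists rev : lorder R, forall x y, rev x y = lhd y x.
Proof.
apply: (@lorder_of_rel _ (fun x y => lhd y x)).
- by move=> x; apply: lorder_irr.
- by move=> y x z yx zy; apply: lorder_trans zy yx.
- by move=> x y; rewrite eq_sym; apply: lorder_total.
Qed.

Lemma between_reverse (R : finType) (lhd rev : lorder R) x y z :
  (forall u v, rev u v = lhd v u) -> between rev x y z = between lhd x y z.
Proof.
by move=> revE; rewrite /between !revE orbC; congr (_ || _); apply: andbC.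
Qed.

(** If [c] lies below [x], the previous construction is run on the reversed axis, which has the same
    single-peaked orders. *)
Lemma single_peaked_side_first (R : finType) (lhd : lorder R) (a x c : R) :
  between lhd a x c ->
  exists P : lorder R, [/\ single_peaked lhd P, is_top P x & P c a].
Proof.
case/orP=> /andP[h1 h2].
  have [P [spP xP Pca]] := single_peaked_up_first lhd x.
  by exists P; split=> //; apply: Pca.
have [rev revE] := reverse_lorder lhd.
have [P [spP xP Pca]] := single_peaked_up_first rev x.
exists P; split=> //; last by apply: Pca; rewrite revE.
apply/(single_peakedP _ xP) => r r'; rewrite -(between_reverse _ _ _ revE).
exact/(single_peakedP _ xP).
Qed.

(** The first step of a nonempty path would be an improving pair at the initial allocation. *)
Lemma swap_stable_reachable (N R : finType) (I : market N R)
    (pi : allocation N R) :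
  swap_stable I (initial I) -> swap_reachable I pi -> pi = initial I.
Proof.
move=> st /connectP[[|pi1 p] //= /andP[/existsP[i /existsP[j /andP[ij _]]] _] _].
by move/forallP/(_ i)/forallP/(_ j): st; rewrite ij.
Qed.

Lemma allocation_inj (N R : finType) (pi : allocation N R) : injective pi.
Proof. by case/andP: (valP pi) => /injectiveP. Qed.

Lemma allocation_surj (N R : finType) (pi : allocation N R) (r : R) :
  exists i, pi i = r.
Proof.
by case/andP: (valP pi) => _ /forallP/(_ r)/codomP[i ->]; exists i.
Qed.

Lemma allocation_inhabited (R : finType) (n : nat) :
  #|R| = n -> inhabited (allocation 'I_n R).
Proof.
move=> <-.
have piP : bijectiveb [ffun i : 'I_#|R| => enum_val i].
  apply/andP; split.
    by apply/injectiveP => i j; rewrite !ffunE => /enum_val_inj.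
  apply/forallP => r; apply/codomP; exists (enum_rank r).
  by rewrite ffunE enum_rankK.
exact: (inhabits (Allocation piP)).
Qed.

Theorem theorem2 (n : nat) (R : finType) (hR : #|R| = n)
  (lhd : lorder R) (D : {set lorder R}) :
  SP lhd \proper D ->
  exists I : market 'I_n R,
    defined_over D I /\
    (forall pi : allocation 'I_n R,
       swap_reachable I pi -> swap_stable I pi -> ~ pareto_optimal I pi).
Proof.
case/properP => /subsetP SPD [P PD]; rewrite inE => /not_single_peaked_valley.
case=> t [a [b [tP abt Pab]]].
(* Any allocation can be the initial one: the three special agents are named after what they own in
   it. *)
have [pi0] := allocation_inhabited hR.
have [ia pia] := allocation_surj pi0 a.
have [ib pib] := allocation_surj pi0 b.
have [it pit] := allocation_surj pi0 t.
have [A [spA aA _]] := single_peaked_up_first lhd a.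
have [B [spB bB Bta]] := single_peaked_side_first abt.
have peak r : exists Q : lorder R, single_peaked lhd Q && is_top Q r.
  by have [Q [spQ rQ _]] := single_peaked_up_first lhd r; exists Q; apply/andP.
pose T r := xchoose (peak r).
have spT r : single_peaked lhd (T r) by case/andP: (xchooseP (peak r)).
have topT r : is_top (T r) r by case/andP: (xchooseP (peak r)).
have Abt : A b t by apply/(single_peakedP _ aA): abt.
have aNb : a != b := lorder_neq Pab.
have tNa : t != a := lorder_neq Bta.
have bNt : b != t := lorder_neq Abt.
have iaNib : ia != ib by rewrite -(inj_eq (@allocation_inj _ _ pi0)) pia pib.
have itNia : it != ia by rewrite -(inj_eq (@allocation_inj _ _ pi0)) pia pit.
have ibNit : ib != it by rewrite -(inj_eq (@allocation_inj _ _ pi0)) pib pit.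
pose pr i := if i == ia then P else if i == ib then A
             else if i == it then B else T (pi0 i).
have pra : pr ia = P by rewrite /pr eqxx.
have prb : pr ib = A by rewrite /pr eq_sym (negPf iaNib) eqxx.
have prt : pr it = B by rewrite /pr (negPf itNia) eq_sym (negPf ibNit) eqxx.
have pr_other i : i \notin [:: ia; ib; it] -> is_top (pr i) (pi0 i).
  rewrite !inE !negb_or => /and3P[/negPf ia' /negPf ib' /negPf it'].
  by rewrite /pr ia' ib' it'.
pose I := Market pr pi0; exists I; split.
  (* [P] lies in [D] by choice; the other orders are single-peaked. *)
  apply/forallP => i; rewrite /= /pr.
  by do 3?[case: ifP => _] => //; apply: SPD; rewrite inE.
have st : swap_stable I pi0.
  apply/forallP => i; apply/forallP => j; apply/negP => /and3P[/= iNj prij prji].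
  (* Every other agent already owns its top, so it never gains. *)
  have owners k r : pr k r (pi0 k) -> [|| k == ia, k == ib | k == it].
    by apply: contraTT => kN; rewrite is_topN // pr_other // !inE.
  have iP := owners _ _ prij; have jP := owners _ _ prji.
  (* In each pair one owner refuses: [ia] keeps [a] over [b], [ib] keeps [b] over [t], and [it]
     keeps [t] over [a]. *)
  move: iNj prij prji; case/or3P: iP => /eqP->; case/or3P: jP => /eqP->;
    by rewrite ?eqxx ?pra ?prb ?prt ?pia ?pib ?pit ?(lorder_asym Pab)
      ?(lorder_asym Abt) ?(lorder_asym Bta) // is_topN.
move=> pi /(swap_stable_reachable st) -> _ /forallP.
(* The three-cycle as a product of two transpositions, which makes it an allocation at once; the
   first swap is not improving, since [ib] loses by it. *)
pose pi1 := swap_deal (swap_deal pi0 ib it) ia ib.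
have pi1a : pi1 ia = t by rewrite !ffunE tpermL tpermL.
have pi1b : pi1 ib = a.
  by rewrite !ffunE tpermR tpermD // eq_sym // eq_sym.
have pi1t : pi1 it = b.
  by rewrite !ffunE (@tpermD _ ia) ?tpermR // eq_sym.
have top1 i : is_top (pr i) (pi1 i).
  have [->|iNa] := eqVneq i ia; first by rewrite pra pi1a.
  have [->|iNb] := eqVneq i ib; first by rewrite prb pi1b.
  have [->|iNt] := eqVneq i it; first by rewrite prt pi1t.
  rewrite !ffunE !tpermD 1?eq_sym //; apply: pr_other.
  by rewrite !inE !negb_or iNa iNb.
move=> /(_ pi1)/negP; apply; apply/andP; split.
  (* Nobody can lose by receiving a top; [ia] gains strictly because [t] differs from [a]. *)
  by apply/forallP => i; apply: is_top_le.
apply/existsP; exists ia; rewrite /= pra pi1a pia.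
by move/forallP/(_ a)/implyP: tP; apply; rewrite eq_sym.
Qed.
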